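(* Let $\gamma$ be an $n$-Frenet helix, with constant curvatures $\kappa_1,\dots,\kappa_{n-1}$, parametrized by the arc length $s$ in the semi-Riemannian space form $N^n_t(c)$, $1\le t\le n-1$. (i) If $n=4$, then $\gamma$ is triharmonic if and only if $$(\epsilon_1\kappa_1^2+\epsilon_3\kappa_2^2)^2+\epsilon_2\epsilon_4\kappa_2^2\kappa_3^2=c\,\epsilon_1\epsilon_2(2\epsilon_1\kappa_1^2+\epsilon_3\kappa_2^2),$$ $$\epsilon_2(\epsilon_1\kappa_1^2+\epsilon_3\kappa_2^2)+\epsilon_3\epsilon_4\kappa_3^2=c\,\epsilon_1.$$ (ii) If $n=5$, then $\gamma$ is triharmonic if and only if $$(\epsilon_1\kappa_1^2+\epsilon_3\kappa_2^2)^2+\epsilon_2\epsilon_4\kappa_2^2\kappa_3^2=c\,\epsilon_1\epsilon_2(2\epsilon_1\kappa_1^2+\epsilon_3\kappa_2^2),$$ $$\epsilon_2(\epsilon_1\kappa_1^2+\epsilon_3\kappa_2^2)+\epsilon_4(\epsilon_3\kappa_3^2+\epsilon_5\kappa_4^2)=c\,\epsilon_1.$$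
   Context: Conventions. For a semi-Riemannian manifold $(M,\langle\,,\rangle)$ with Levi-Civita connection $\nabla$, $R(X,Y)Z=\nabla_X\nabla_YZ-\nabla_Y\nabla_XZ-\nabla_{[X,Y]}Z$. Curves $\gamma:I\to M$ ($I$ an open real interval) are smooth, nonnull, parametrized by arc length; $T=\gamma'$. Put $\nabla_T^0T=T$, $\nabla_T^jT=\nabla_T(\nabla_T^{j-1}T)$. A curve is triharmonic ($3$-harmonic) if $$\tau_3(\gamma)=\nabla^{5}_T T+R\big(\nabla^{3}_T T,T\big)T-R\big(\nabla^{2}_T T,\nabla_T T\big)T=0.$$ An $n$-Frenet curve is a curve admitting a frame field $\{F_1=T,F_2,\dots,F_n\}$ along it with $\langle F_j,F_j\rangle=\epsilon_j=\pm1$, $\langle F_i,F_j\rangle=0$ for $i\ne j$, and $$\nabla_TF_1=\epsilon_2k_1F_2,\quad \nabla_TF_i=-\epsilon_{i-1}k_{i-1}F_{i-1}+\epsilon_{i+1}k_iF_{i+1}\ (1<i<n),\quad \nabla_TF_n=-\epsilon_{n-1}k_{n-1}F_{n-1},$$ where the curvatures $k_1(s),\dots,k_{n-1}(s)$ are positive functions (if the ambient space is oriented of dimension $n$, $k_{n-1}$ is allowed to take any real value, $F_n$ being fixed by requiring $\{F_1,\dots,F_n\}$ to be positively oriented). It is a helix if all curvatures are constant, denoted $\kappa_1,\dots,\kappa_{n-1}$. Space forms: let $\mathbb{R}^d_t$ be $\mathbb{R}^d$ with $\langle x,y\rangle=-\sum_{i=1}^t x_iy_i+\sum_{i=t+1}^d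 x_iy_i$. $N^n_t(c)$ denotes $\mathbb{R}^n_t$ if $c=0$, $\{x\in\mathbb{R}^{n+1}_t:\langle x,x\rangle=1/c\}$ if $c>0$, $\{x\in\mathbb{R}^{n+1}_{t+1}:\langle x,x\rangle=1/c\}$ if $c<0$, with the induced metric of index $t$; its curvature is $R(X,Y)Z=c(\langle Y,Z\rangle X-\langle X,Z\rangle Y)$.
   Formalization: In part (i) κ_3 ≠ 0 is assumed; this is automatic when curvatures are positive, but when the oriented convention lets κ_3 be any real, the claim fails at κ_3 = 0 (e.g. t=c=1, ε=(1,1,1,-1), κ_1²=κ_2²=3/4: triharmonic, yet the second equation reads 3/2=1). *)

(* Defs.v *)
From HB Require Import structures.
From mathcomp Require Import all_boot all_order all_algebra.
From mathcomp Require Import all_classical all_reals all_analysis.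

Set Implicit Arguments.
Unset Strict Implicit.
Unset Printing Implicit Defensive.

Import Order.TTheory GRing.Theory Num.Theory.
Import numFieldNormedType.Exports.
Local Open Scope classical_set_scope.
Local Open Scope ring_scope.

Definition sprod (R : realType) (d t : nat) (x y : 'rV[R]_d) : R :=
  \sum_(i < d) (if (i < t)%N then -1 else 1) * (x ord0 i * y ord0 i).

(* N^m_t(c) sits in R^d_q with d = adim m c and q = aindex t c. *)
Definition adim (R : realType) (m : nat) (c : R) : nat :=
  if c == 0 then m else m.+1.

Definition aindex (R : realType) (t : nat) (c : R) : nat :=
  if c < 0 then t.+1 else t.

Definition metric (R : realType) (m t : nat) (c : R)
  (x y : 'rV[R]_(adim m c)) : R := sprod (aindex t c) x y.

Definition in_space_form (R : realType) (m t : nat) (c : R)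
  (p : 'rV[R]_(adim m c)) : Prop := c != 0 -> metric t p p = c^-1.

Definition tangent_at (R : realType) (m t : nat) (c : R)
  (p v : 'rV[R]_(adim m c)) : Prop := c != 0 -> metric t v p = 0.

(* Orthogonal projection of the ambient space onto the tangent space at p;
   for c != 0 the normal line is spanned by p. *)
Definition tanproj (R : realType) (m t : nat) (c : R)
  (p v : 'rV[R]_(adim m c)) : 'rV[R]_(adim m c) :=
  if c == 0 then v else v - (metric t v p / metric t p p) *: p.

(* Covariant derivative along gamma of a tangent field V for the Levi-Civita
   connection of the induced metric: by the Gauss formula, the tangential part
   of the flat derivative. *)
Definition covd (R : realType) (m t : nat) (c : R)
  (gamma V : R -> 'rV[R]_(adim m c)) (s : R) : 'rV[R]_(adim m c) :=
  tanproj t (gamma s) (derive1 V s).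

Definition nablaT (R : realType) (m t : nat) (c : R)
  (gamma : R -> 'rV[R]_(adim m c)) (j : nat) : R -> 'rV[R]_(adim m c) :=
  iter j (covd t gamma) (derive1 gamma).

Definition Rcurv (R : realType) (m t : nat) (c : R)
  (X Y Z : 'rV[R]_(adim m c)) : 'rV[R]_(adim m c) :=
  c *: (metric t Y Z *: X - metric t X Z *: Y).

Definition tau3 (R : realType) (m t : nat) (c : R)
  (gamma : R -> 'rV[R]_(adim m c)) (s : R) : 'rV[R]_(adim m c) :=
  let D j := nablaT t gamma j s in
  D 5%N + Rcurv t (D 3%N) (D 0%N) (D 0%N) - Rcurv t (D 2%N) (D 1%N) (D 0%N).

Definition triharmonic (R : realType) (m t : nat) (c : R) (I : set R)
  (gamma : R -> 'rV[R]_(adim m c)) : Prop :=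
  forall s, I s -> tau3 t gamma s = 0.

Definition open_interval (R : realType) (I : set R) : Prop :=
  [/\ open I, is_interval I & I !=set0].

Definition smooth_on (R : realType) (d : nat) (I : set R)
  (f : R -> 'rV[R]_d) : Prop :=
  forall (j : nat) (s : R), I s -> derivable (derive1n j f) s 1.

Definition arclength_curve (R : realType) (m t : nat) (c : R) (I : set R)
  (gamma : R -> 'rV[R]_(adim m c)) : Prop :=
  [/\ open_interval I, smooth_on I gamma,
      forall s, I s -> in_space_form t (gamma s) &
      forall s, I s -> `|metric t (derive1 gamma s) (derive1 gamma s)| = 1].

(* An orientation of N^m_t(c) is a sign b: the frame F_1, ..., F_m at p is
   positive when the determinant with rows F_1, ..., F_m, and p as last row if
   c != 0, has sign (-1)^b. *)
Definition positively_oriented (R : realType) (m : nat) (c : R) (b : bool)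
  (p : 'rV[R]_(adim m c)) (F : nat -> 'rV[R]_(adim m c)) : Prop :=
  0 < (-1) ^+ b * \det (\matrix_(i < adim m c, j < adim m c)
                         (if (i < m)%N then F i.+1 ord0 j else p ord0 j)).

(* Indices of F, eps and k start at 1. The argument o is None when the ambient
   space carries no orientation, and Some b when it carries orientation b;
   the latter matters only for n = m, where k_(n-1) is then an arbitrary
   real-valued function. *)
Record frenet_curve (R : realType) (n m t : nat) (c : R) (o : option bool)
  (I : set R) (gamma : R -> 'rV[R]_(adim m c))
  (F : nat -> R -> 'rV[R]_(adim m c)) (eps : nat -> R)
  (k : nat -> R -> R) : Prop := FrenetCurve {
  frenet_order : (2 <= n)%N;
  frenet_arclength : arclength_curve t I gamma;
  frenet_smooth : forall i, (1 <= i <= n)%N -> smooth_on I (F i);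
  frenet_tangent : forall i s, (1 <= i <= n)%N -> I s ->
    tangent_at t (gamma s) (F i s);
  frenet_velocity : forall s, I s -> F 1%N s = derive1 gamma s;
  frenet_sign : forall i, (1 <= i <= n)%N -> eps i = 1 \/ eps i = -1;
  frenet_norm : forall i s, (1 <= i <= n)%N -> I s ->
    metric t (F i s) (F i s) = eps i;
  frenet_orthogonal : forall i j s, (1 <= i <= n)%N -> (1 <= j <= n)%N ->
    i != j -> I s -> metric t (F i s) (F j s) = 0;
  frenet_eq_first : forall s, I s ->
    covd t gamma (F 1%N) s = (eps 2%N * k 1%N s) *: F 2%N s;
  frenet_eq_middle : forall i s, (1 < i < n)%N -> I s ->
    covd t gamma (F i) s = - (eps i.-1 * k i.-1 s) *: F i.-1 s
                           + (eps i.+1 * k i s) *: F i.+1 s;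
  frenet_eq_last : forall s, I s ->
    covd t gamma (F n) s = - (eps n.-1 * k n.-1 s) *: F n.-1 s;
  frenet_curvature_gt0 : forall i s, (1 <= i < n.-1)%N -> I s -> 0 < k i s;
  frenet_curvature_last : forall s, I s ->
    match o with
    | Some b => if n == m then positively_oriented b (gamma s) (F^~ s)
                else 0 < k n.-1 s
    | None => 0 < k n.-1 s
    end
}.

Definition frenet_helix (R : realType) (n m t : nat) (c : R) (o : option bool)
  (I : set R) (gamma : R -> 'rV[R]_(adim m c))
  (F : nat -> R -> 'rV[R]_(adim m c)) (eps : nat -> R)
  (k : nat -> R -> R) (kappa : nat -> R) : Prop :=
  frenet_curve n t o I gamma F eps k /\
  (forall i s, (1 <= i < n)%N -> I s -> k i s = kappa i).

(* Main.v *)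
Require Import Defs.
From HB Require Import structures.
From mathcomp Require Import all_boot all_order all_algebra.
From mathcomp Require Import all_classical all_reals all_analysis.
From mathcomp Require Import ring zify.

Set Implicit Arguments.
Unset Strict Implicit.

Import Order.TTheory GRing.Theory Num.Theory.
Import numFieldNormedType.Exports.
Local Open Scope classical_set_scope.
Local Open Scope ring_scope.

(* Along a helix the covariant derivative of a combination of the frame with
   constant coefficients is again such a combination, so tau_3 is computed by
   iterating a tridiagonal operator on the coefficients. Only the F_2 and F_4
   components survive, and they are the two curvature conditions up to the
   nonzero factors kappa_1 and kappa_1 kappa_2 kappa_3; nondegeneracy of the
   metric on the frame separates them. *)

(** * Linearity of the metric, the projection and the covariant derivative *)

Lemma metricDl (R : realType) (m t : nat) (c : R) (u v w : 'rV[R]_(adim m c)) :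
  metric t (u + v) w = metric t u w + metric t v w.
Proof.
rewrite /metric /sprod -big_split /=; apply: eq_bigr => i _.
by rewrite mxE mulrDl mulrDr.
Qed.

Lemma metricZl (R : realType) (m t : nat) (c a : R)
    (u w : 'rV[R]_(adim m c)) :
  metric t (a *: u) w = a * metric t u w.
Proof.
rewrite /metric /sprod mulr_sumr; apply: eq_bigr => i _.
by rewrite mxE; ring.
Qed.

Lemma metric0l (R : realType) (m t : nat) (c : R) (w : 'rV[R]_(adim m c)) :
  metric t 0 w = 0.
Proof. by rewrite -(scale0r 0) metricZl mul0r. Qed.

Lemma metric_suml (R : realType) (m t : nat) (c : R) (J : Type) (r : seq J)
    (a : J -> R) (v : J -> 'rV[R]_(adim m c)) (w : 'rV[R]_(adim m c)) :
  metric t (\sum_(j <- r) a j *: v j) w = \sum_(j <- r) a j * metric t (v j) w.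
Proof.
elim: r => [|j r IH]; first by rewrite !big_nil metric0l.
by rewrite !big_cons metricDl metricZl IH.
Qed.

Lemma tanproj_sum (R : realType) (m t : nat) (c : R) (p : 'rV[R]_(adim m c))
    (J : Type) (r : seq J) (a : J -> R) (v : J -> 'rV[R]_(adim m c)) :
  tanproj t p (\sum_(j <- r) a j *: v j) = \sum_(j <- r) a j *: tanproj t p (v j).
Proof.
rewrite /tanproj; case: ifP => // _; rewrite metric_suml mulr_suml scaler_suml.
rewrite -sumrB; apply: eq_bigr => j _.
by rewrite scalerBr scalerA mulrA.
Qed.

Lemma covd_sum (R : realType) (m t : nat) (c : R) (I : set R)
    (gamma V : R -> 'rV[R]_(adim m c)) (N : nat) (a : 'I_N -> R)
    (G : 'I_N -> R -> 'rV[R]_(adim m c)) (s : R) :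
  open I -> I s -> (forall i, derivable (G i) s 1) ->
  (forall u, I u -> V u = \sum_(i < N) a i *: G i u) ->
  covd t gamma V s = \sum_(i < N) a i *: covd t gamma (G i) s.
Proof.
move=> oI Is dG VE; rewrite /covd -tanproj_sum; congr tanproj.
under eq_bigr => i _ do rewrite derive1E -deriveZ //.
rewrite derive1E -derive_sum; last by move=> i; exact/derivableZ.
(* [V] agrees with the combination only on [I]; as [I] is open, this holds near [s], which is all
   that the derivative sees. *)
apply: near_eq_derive; near=> u.
rewrite fct_sumE; apply: VE; near: u.
exact: open_nbhs_nbhs.
Unshelve. all: by end_near. Qed.

(** * The Frenet equations as a tridiagonal operator on coefficients *)

(* The i-th coefficient of nabla_T (sum_j a_j F_j). *)
Definition frenet_step {R : realType} (eps k a : nat -> R) (i : nat) : R :=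
  eps i * (k i.-1 * a i.-1 - k i * a i.+1).

(* Setting the frame fields beyond the order n of the curve, and the curvatures
   outside 1, ..., n-1, to 0 makes the first and last Frenet equations instances
   of the middle one; it also lets n = 4 and n = 5 be treated together, with
   kappa_4 = 0 in the former case. *)
Definition cut_frame {V : nmodType} {T : Type} (n : nat) (F : nat -> T -> V)
  (i : nat) (s : T) : V := if (i <= n)%N then F i s else 0.

Definition cut_curvature {V : nmodType} (n : nat) (k : nat -> V) (i : nat) : V :=
  if (0 < i < n)%N then k i else 0.

Lemma covd_cut_frame (R : realType) (n m t : nat) (c : R) (o : option bool)
    (I : set R) (gamma : R -> 'rV[R]_(adim m c))
    (F : nat -> R -> 'rV[R]_(adim m c)) (eps : nat -> R) (k : nat -> R -> R)
    (kappa : nat -> R) (i : nat) (s : R) :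
  frenet_helix n t o I gamma F eps k kappa -> I s -> (0 < i)%N ->
  let F' := cut_frame n F in let k' := cut_curvature n kappa in
  covd t gamma (F' i) s =
    - (eps i.-1 * k' i.-1) *: F' i.-1 s + (eps i.+1 * k' i) *: F' i.+1 s.
Proof.
move=> [fc kE] Is i0 /=; have n2 := frenet_order fc.
rewrite /cut_frame /cut_curvature; have [ni|] := leqP i n; last first.
  move=> ni; rewrite /covd derive1_cst.
  (* At [i = n + 1] the neighbour [F n] is not zero; it is its coefficient, containing [k' n], that
     vanishes. *)
  have -> : (0 < i < n)%N = false by lia.
  have -> : (0 < i.-1 < n)%N = false by lia.
  rewrite !mulr0 oppr0 !scale0r addr0.
  by rewrite /tanproj metric0l mul0r scale0r subr0 if_same.
have [->|i1] := eqVneq i 1%N.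
  rewrite /= mulr0 oppr0 scale0r add0r !ifT //.
  by rewrite (frenet_eq_first fc Is) (kE 1%N).
have [iE|iN] := eqVneq i n.
  rewrite iE (frenet_eq_last fc Is) (kE n.-1) //; last by lia.
  by rewrite ltnn andbF mulr0 scale0r addr0 !ifT //; lia.
rewrite !ifT; try lia.
rewrite (frenet_eq_middle fc) //; last by lia.
by rewrite !kE //; lia.
Qed.

(** Summation by parts: the two sides differ by a telescoping sum, whose [u i] gathers the exchange
    between [F i] and [F i.+1]. Each [u i] carries the factor [k i], so both boundary terms
    vanish. *)
Lemma frenet_step_sum {R : realType} {d : nat} (N : nat)
    (eps k a : nat -> R) (F : nat -> 'rV[R]_d) :
  k 0%N = 0 -> k N = 0 ->
  \sum_(i < N) a i.+1 *: (- (eps i * k i) *: F i + (eps i.+2 * k i.+1) *: F i.+2)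
  = \sum_(i < N) frenet_step eps k a i.+1 *: F i.+1.
Proof.
move=> k0 kN; apply/eqP; rewrite -subr_eq0 -sumrB.
pose u i := (eps i.+1 * k i * a i) *: F i.+1 + (eps i * k i * a i.+1) *: F i.
have uE i : k i = 0 -> u i = 0.
  by move=> ki; rewrite /u ki !(mulr0, mul0r, scale0r) addr0.
rewrite -(big_mkord xpredT (fun i => a i.+1 *: (- (eps i * k i) *: F i
  + (eps i.+2 * k i.+1) *: F i.+2) - frenet_step eps k a i.+1 *: F i.+1)).
rewrite (@telescope_sumr_eq _ 0%N N u) // => [|i _]; first by rewrite !uE // subrr.
by apply/rowP => l; rewrite /u /frenet_step !mxE; ring.
Qed.

(** Frame coefficients of $\nabla_T^j T$; the seed is $T = F_1$. *)
Definition frenet_coef {R : realType} (eps k : nat -> R) (j : nat) : nat -> R :=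
  iter j (frenet_step eps k) (fun i => (i == 1%N)%:R).

Arguments frenet_coef : simpl never.

(** * Iterated derivatives and $\tau_3$ in the padded frame *)

Section helix.
Context {R : realType} {n m t : nat} {c : R} {o : option bool} {I : set R}.
Context {gamma : R -> 'rV[R]_(adim m c)} {F : nat -> R -> 'rV[R]_(adim m c)}.
Context {eps : nat -> R} {k : nat -> R -> R} {kappa : nat -> R}.
Hypothesis helix : frenet_helix n t o I gamma F eps k kappa.

Let F' := cut_frame n F.
Let k' := cut_curvature n kappa.
Local Notation D := (frenet_coef eps k').

Lemma nablaT_helix (N j : nat) (s : R) : (n <= N)%N -> I s ->
  nablaT t gamma j s = \sum_(i < N) D j i.+1 *: F' i.+1 s.
Proof.
have [fc _] := helix; have n2 := frenet_order fc.
have [[oI _ _] _ _ _] := frenet_arclength fc.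
move=> nN; elim: j s => [|j IH] s Is.
  case: N nN => [|N] nN; first by lia.
  rewrite big_ord_recl big1 => [|i _]; last by rewrite /= scale0r.
  rewrite addr0 scale1r /F' /cut_frame ifT; last exact: ltnW.
  exact/esym/(frenet_velocity fc).
rewrite {1}/nablaT iterS -/(nablaT t gamma j).
have dF (i : 'I_N) : derivable (F' i.+1) s 1.
  rewrite /F' /cut_frame; case: ltnP => ni; last exact: derivable_cst.
  by have smoothF := frenet_smooth fc (i := i.+1) ni; exact: (smoothF 0%N).
rewrite (covd_sum (a := fun i : 'I_N => D j i.+1) t gamma oI Is dF IH).
rewrite -(frenet_step_sum eps _ (F' ^~ s)); first last.
- by rewrite /k' /cut_curvature ifF //; lia.
- by [].
by apply: eq_bigr => i _; rewrite (covd_cut_frame helix).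
Qed.

Lemma metric_frame_sum (N j : nat) (a : nat -> R) (s : R) :
  (j < n <= N)%N -> I s ->
  metric t (\sum_(i < N) a i.+1 *: F' i.+1 s) (F' j.+1 s) = a j.+1 * eps j.+1.
Proof.
move=> /andP[jn nN] Is; have [fc _] := helix.
rewrite metric_suml (bigD1 (Ordinal (leq_trans jn nN))) //= big1 => [|i ij].
  by rewrite addr0 /F' /cut_frame jn (frenet_norm fc).
rewrite /F' /cut_frame jn; case: ifP => ni; last by rewrite metric0l mulr0.
by rewrite (frenet_orthogonal fc) ?mulr0.
Qed.

Let DS j i : D j.+1 i.+1 = eps i.+1 * (k' i * D j i - k' i.+1 * D j i.+2).
Proof. by []. Qed.

Let k'0 : k' 0%N = 0. Proof. by []. Qed.

(** Each derivative moves an index by exactly one, starting from index 1. The fictitious index 0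
    receives nothing because [k' 0 = 0]. *)
Lemma frenet_coef_parity (i j : nat) : ~~ odd (i + j) -> D j i = 0.
Proof.
elim: j i => [|j IH] [|i] ij.
- by [].
- by case: i ij.
- by rewrite /frenet_coef iterS /frenet_step k'0 !mul0r subr0 mulr0.
by rewrite DS (IH i) ?(IH i.+2) ?mulr0 ?subr0 ?mulr0 //; lia.
Qed.

(** In the curvature terms parity kills the $T$-components of $\nabla_T T$ and $\nabla_T^3 T$,
    leaving $c\epsilon_1\nabla_T^3 T$ and $c\langle\nabla_T^2 T,T\rangle\nabla_T T$. *)
Lemma tau3_helix (N : nat) (s : R) : (n <= N)%N -> I s ->
  tau3 t gamma s = \sum_(i < N)
    (D 5 i.+1 + c * eps 1%N * (D 3 i.+1 + D 2 1%N * D 1 i.+1)) *: F' i.+1 s.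
Proof.
move=> nN Is; have [fc _] := helix; have n2 := frenet_order fc.
have TE : nablaT t gamma 0 s = F' 1%N s.
  by rewrite /F' /cut_frame ifT ?(frenet_velocity fc) //; lia.
have metricT j : metric t (nablaT t gamma j s) (nablaT t gamma 0 s) =
    D j 1%N * eps 1%N.
  by rewrite TE (nablaT_helix _ nN Is) metric_frame_sum //; lia.
have nE j := nablaT_helix j nN Is.
rewrite /tau3 /Rcurv; move: (nablaT t gamma) metricT nE => W metricT nE.
rewrite !metricT !nE.
rewrite !scaler_sumr -!sumrB !scaler_sumr -big_split -sumrB /=.
apply: eq_bigr => i _; rewrite (frenet_coef_parity (i := 1%N) (j := 1%N)) //.
rewrite (frenet_coef_parity (i := 1%N) (j := 3%N)) // (_ : D 0 1%N = 1) //.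
by apply/rowP => l; rewrite !mxE; ring.
Qed.

(** * Orders 4 and 5 *)

Lemma sqr_frenet_sign (i : nat) : (0 < i <= n)%N -> eps i ^+ 2 = 1.
Proof.
have [fc _] := helix.
by move=> le_in; have [->|->] := frenet_sign fc le_in; rewrite ?sqrrN expr1n.
Qed.

Lemma tau3_helix5 (s : R) : (4 <= n <= 5)%N -> I s ->
  tau3 t gamma s =
    (kappa 1%N * eps 2%N *
      ((eps 1%N * kappa 1%N ^+ 2 + eps 3%N * kappa 2%N ^+ 2) ^+ 2
         + eps 2%N * eps 4%N * kappa 2%N ^+ 2 * kappa 3%N ^+ 2
       - c * eps 1%N * eps 2%N
         * (2 * eps 1%N * kappa 1%N ^+ 2 + eps 3%N * kappa 2%N ^+ 2)))
      *: F' 2%N s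
  + (kappa 1%N * kappa 2%N * kappa 3%N * (eps 2%N * eps 3%N * eps 4%N) *
      (c * eps 1%N
       - (eps 2%N * (eps 1%N * kappa 1%N ^+ 2 + eps 3%N * kappa 2%N ^+ 2)
          + eps 4%N * (eps 3%N * kappa 3%N ^+ 2 + eps 5%N * k' 4%N ^+ 2))))
      *: F' 4%N s.
Proof.
move=> n45 Is; rewrite (tau3_helix (N := 5%N)) //; last by lia.
(* Index 5 is left out: for [n = 4] nothing is known of [eps 5], which occurs only next to [k' 4],
   zero in that case. *)
have e2 i : (0 < i < 5)%N -> eps i ^+ 2 = 1.
  by move=> i5; apply: sqr_frenet_sign; lia.
have k'E i : (0 < i < 4)%N -> k' i = kappa i.
  by move=> i4; rewrite /k' /cut_curvature ifT //; lia.
have k'5 : k' 5%N = 0 by rewrite /k' /cut_curvature ifF //; lia.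
have [[k'1 k'2] k'3] := (k'E 1%N isT, k'E 2%N isT, k'E 3%N isT).
rewrite !big_ord_recr big_ord0 /= add0r.
have D0 i j (ij : ~~ odd (i + j)) := frenet_coef_parity ij.
rewrite !(D0 1%N 5%N, D0 1%N 3%N, D0 1%N 1%N, D0 3%N 5%N, D0 3%N 3%N, D0 3%N 1%N,
  D0 5%N 5%N, D0 5%N 3%N, D0 5%N 1%N) //.
rewrite !(addr0, mulr0, scale0r, add0r); congr (_ *: _ + _ *: _).
  rewrite !(DS, k'0, k'1, k'2, k'3, k'5) /frenet_coef /=.
  ring: (e2 1%N isT) (e2 2%N isT) (e2 3%N isT) (e2 4%N isT).
rewrite !(DS, k'0, k'1, k'2, k'3, k'5) /frenet_coef /=.
ring: (e2 1%N isT) (e2 2%N isT) (e2 3%N isT) (e2 4%N isT).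
Qed.

(** Dividing the $F_4$ component by its factor requires [kappa 3] to be nonzero. Positivity would be
    too much to ask: for [n = 4] this is the last curvature, whose sign may be free. *)
Lemma triharmonic_helix : (4 <= n <= 5)%N ->
  0 < kappa 1%N -> 0 < kappa 2%N -> kappa 3%N != 0 ->
  triharmonic t I gamma <->
  (eps 1%N * kappa 1%N ^+ 2 + eps 3%N * kappa 2%N ^+ 2) ^+ 2
    + eps 2%N * eps 4%N * kappa 2%N ^+ 2 * kappa 3%N ^+ 2
  = c * eps 1%N * eps 2%N
      * (2 * eps 1%N * kappa 1%N ^+ 2 + eps 3%N * kappa 2%N ^+ 2) /\
  eps 2%N * (eps 1%N * kappa 1%N ^+ 2 + eps 3%N * kappa 2%N ^+ 2)
    + eps 4%N * (eps 3%N * kappa 3%N ^+ 2 + eps 5%N * k' 4%N ^+ 2)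
  = c * eps 1%N.
Proof.
move=> n45 k1 k2 k3; have [fc _] := helix.
(* The two conditions do not involve the parameter, so a single point of [I] yields them. *)
have [[_ _ [s Is]] _ _ _] := frenet_arclength fc.
have eN0 i : (0 < i < 5)%N -> eps i != 0.
  by move=> i5; rewrite -sqrf_eq0 sqr_frenet_sign ?oner_eq0 //; lia.
split=> [tau0|[AB AB'] u Iu]; last first.
  by rewrite tau3_helix5 // AB -AB' !subrr !mulr0 !scale0r addr0.
have := tau0 s Is; rewrite tau3_helix5 //.
set a := _ * (_ - _); set b := _ * (_ - _) => tau0s.
(* Pairing with [F' j.+1] extracts one coefficient times a nonzero sign; the indicators write $aF_2
   + bF_4$ as a sum over the whole frame. *)
have coef0 j : (j < 4)%N -> a * (j == 1%N)%:R + b * (j == 3%N)%:R = 0.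
  move=> j4; apply: (mulIf (eN0 j.+1 _)) => //; rewrite mul0r.
  have j5 : (j < n <= 5)%N by lia.
  have := metric_frame_sum (fun i => a * (i == 2%N)%:R + b * (i == 4%N)%:R) j5 Is.
  rewrite !big_ord_recr big_ord0 /= !(mulr0, mulr1, addr0, add0r, scale0r).
  by rewrite tau0s metric0l.
have := coef0 1%N isT; have := coef0 3%N isT.
rewrite !(mulr0, mulr1, addr0, add0r) => /eqP b0 /eqP a0; move: a0 b0.
rewrite !mulf_eq0 !(gt_eqF k1, gt_eqF k2, negPf k3) !(negPf (eN0 _ _)) //= !subr_eq0.
by move=> /eqP-> /eqP->.
Qed.

End helix.

Theorem theorem1p21 (R : realType) (n t : nat) (c : R) (o : option bool)
  (I : set R) (gamma : R -> 'rV[R]_(adim n c))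
  (F : nat -> R -> 'rV[R]_(adim n c)) (eps : nat -> R)
  (k : nat -> R -> R) (kappa : nat -> R)
  (ht : (1 <= t <= n.-1)%N)
  (hgamma : frenet_helix n t o I gamma F eps k kappa) :
  (n = 4%N -> kappa 3%N != 0 ->
    (triharmonic t I gamma <->
      (eps 1%N * kappa 1%N ^+ 2 + eps 3%N * kappa 2%N ^+ 2) ^+ 2
        + eps 2%N * eps 4%N * kappa 2%N ^+ 2 * kappa 3%N ^+ 2
      = c * eps 1%N * eps 2%N
          * (2 * eps 1%N * kappa 1%N ^+ 2 + eps 3%N * kappa 2%N ^+ 2) /\
      eps 2%N * (eps 1%N * kappa 1%N ^+ 2 + eps 3%N * kappa 2%N ^+ 2)
        + eps 3%N * eps 4%N * kappa 3%N ^+ 2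
      = c * eps 1%N)) /\
  (n = 5%N ->
    (triharmonic t I gamma <->
      (eps 1%N * kappa 1%N ^+ 2 + eps 3%N * kappa 2%N ^+ 2) ^+ 2
        + eps 2%N * eps 4%N * kappa 2%N ^+ 2 * kappa 3%N ^+ 2
      = c * eps 1%N * eps 2%N
          * (2 * eps 1%N * kappa 1%N ^+ 2 + eps 3%N * kappa 2%N ^+ 2) /\
      eps 2%N * (eps 1%N * kappa 1%N ^+ 2 + eps 3%N * kappa 2%N ^+ 2)
        + eps 4%N * (eps 3%N * kappa 3%N ^+ 2 + eps 5%N * kappa 4%N ^+ 2)
      = c * eps 1%N)).
Proof.
have [fc kE] := hgamma; have [[_ _ [s Is]] _ _ _] := frenet_arclength fc.
have kgt0 i : (0 < i < n.-1)%N -> 0 < kappa i.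
  by move=> i1; rewrite -(kE i s) ?(frenet_curvature_gt0 fc) //; lia.
have main := triharmonic_helix hgamma.
(* For [n = 4] the cut makes [k' 4] zero and the [eps 5] term drops out. For [n = 5], [kappa 3] is
   not the last curvature, hence is positive. *)
split=> [nE k3|nE]; subst n; rewrite main ?kgt0 // /cut_curvature /=.
  by rewrite expr0n /= mulr0 addr0 mulrA (mulrC (eps 4%N)).
by rewrite gt_eqF ?kgt0.
Qed.
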